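(* Let $E$ be a nonempty pointless frame, let $W$ be a plenary family of maximal proper round filters on $E$, and let $L_W''=\{(a,\chi_Z)\in E\times\mathbb{2}^W: Z\subseteq W_a \text{ and } W_a\setminus Z\text{ is finite}\}$ and $E'=\{(a,\chi_{W_a}):a\in E\}$. Let $L_W^\star$ be the family of all joins (in $E\times\mathbb{2}^W$) of elements of $L_W''$. Then $L_W^\star$ has the following properties. (1) $L_W^\star$ is a completely regular subframe of $E\times\mathbb{2}^W$, and is the smallest subframe of $E\times\mathbb{2}^W$ containing $E'\cup\{(\top,\chi_{W\setminus\{w\}}):w\in W\}$. (2) $\max L_W^\star=\{(\top,\chi_{W\setminus\{w\}}):w\in W\}$. (3) The pointless part of $L_W^\star$ has $E$ as a quotient, in the sense that $E'$ is a sublocale of $\pi L_W^\star$, and if $q:\pi L_W^\star\to E'$ denotes the quotient map, then $q\circ\pi_{L_W^\star}:L_W^\star\to E'$ is the map $(a,\chi_Z)\mapsto(a,\chi_{W_a})$.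
   Context: All frames are completely regular unless otherwise stated. $\max L$ is the set of maximal elements of $L\setminus\{\top\}$; a frame $L$ is pointless if $\max L=\emptyset$, and nonempty if it has more than one element. An element $c$ is a successor of $a$ if $c>a$ and there is no $b$ with $a<b<c$. The pointless part of $L$ is the sublocale $\pi L=\{a\in L:a\text{ has no successor}\}$, with quotient map $\pi_L:L\to\pi L$, $\pi_L(b)=\bigwedge\{a\in\pi L:a\ge b\}$. A filter $x$ on a frame is proper if $\bot\notin x$ and round if for every $a\in x$ there is $b\in x$ completely below $a$; a maximal proper round filter is one that is maximal under inclusion among proper round filters. A family of filters is independent if any two distinct members contain disjoint elements. A family $W$ of filters on $E$ is plenary if it is nonempty, independent, and for every $\bot<a\in E$ there is $w\in W$ with $a\in w$. $\mathbb{2}=\{\bot,\top\}$ is the two-element frame, $\mathbb{2}^W$ the power, and $\chi_Z\in\mathbb{2}^W$ is the characteristic function of $Z\subseteq W$. For $a\in E$, $W_a=\{w\in W:a\in w\}$. *)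

(* Defs.v *)
From HB Require Import structures.
From mathcomp Require Import all_boot all_order all_algebra.
From mathcomp Require Import boolp classical_sets functions cardinality.
Set Implicit Arguments.
Unset Strict Implicit.
Unset Printing Implicit Defensive.
Import Order.TTheory.
Import Order.ProdSyntax.
Local Open Scope order_scope.

HB.mixin Record TBDistrLattice_isFrame d T of Order.TBDistrLattice d T := {
  bigsup : set T -> T;
  bigsupP : forall A : set T, supremums A (bigsup A);
  meet_bigsup : forall (x : T) (A : set T),
    x `&` bigsup A = bigsup [set (x `&` y)%O | y in A]%classic
}.

#[short(type="frameType")]
HB.structure Definition Frame d :=
  { T of TBDistrLattice_isFrame d T & Order.TBDistrLattice d T }.

(* A meet-semilattice with all joins and the nontrivial half of the infinite
   distributive law is a frame. *)
HB.factory Record MeetSemilattice_isFrame d T of Order.MeetSemilattice d T := {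
  bigsup : set T -> T;
  bigsupP : forall A : set T, supremums A (bigsup A);
  meet_bigsup_le : forall (x : T) (A : set T),
    x `&` bigsup A <= bigsup [set (x `&` y)%O | y in A]%classic
}.

HB.builders Context d T of MeetSemilattice_isFrame d T.

Let ub (A : set T) x : A x -> x <= bigsup A.
Proof. by case: (bigsupP A) => + _; apply. Qed.

Let least (A : set T) z : (forall x, A x -> x <= z) -> bigsup A <= z.
Proof. by case: (bigsupP A) => _; apply. Qed.

Let join x y := bigsup [set x; y]%classic.

Let leUx x y z : (join x y <= z) = (x <= z) && (y <= z).
Proof.
apply/idP/andP => [h|[xz yz]]; last by apply: least => _ [->|->].
by split; apply: le_trans h; apply: ub; [left|right].
Qed.

HB.instance Definition _ := Order.POrder_isJoinSemilattice.Build d T leUx.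

Let le0x x : bigsup set0 <= x. Proof. exact: least. Qed.

HB.instance Definition _ := @Order.hasBottom.Build d T (bigsup set0) le0x.

Let lex1 x : x <= bigsup setT. Proof. exact: ub. Qed.

HB.instance Definition _ := @Order.hasTop.Build d T (bigsup setT) lex1.

Let meetUl : @left_distributive T T Order.meet Order.join.
Proof.
move=> x y z; apply/eqP; rewrite eq_le; apply/andP; split; last first.
  by rewrite leUx !lexI !leIr !andbT; apply/andP; split;
     apply: le_trans (leIl _ _) _; apply: ub; [left|right].
rewrite meetC; apply: le_trans (meet_bigsup_le _ _) _.
apply: least => _ [u [->|->] <-]; rewrite meetC.
  by apply: ub; left.
by apply: ub; right.
Qed.

HB.instance Definition _ := Order.Lattice_Meet_isDistrLattice.Build d T meetUl.

Let meet_bigsup (x : T) (A : set T) :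
  x `&` bigsup A = bigsup [set (x `&` y)%O | y in A]%classic.
Proof.
apply/eqP; rewrite eq_le meet_bigsup_le /=; apply: least => _ [y Ay <-].
by rewrite lexI leIl /= (le_trans (leIr _ _)) // ub.
Qed.

HB.instance Definition _ := TBDistrLattice_isFrame.Build d T bigsupP meet_bigsup.

HB.end.

Section FrameTheory.
Context {d : Order.disp_t} {L : frameType d}.
Implicit Types (a b c s x y z : L) (A S : set L).

Lemma bigsup_ub A x : A x -> x <= bigsup A.
Proof. by case: (bigsupP A) => + _; apply. Qed.

Lemma bigsup_least A z : (forall x, A x -> x <= z) -> bigsup A <= z.
Proof. by case: (bigsupP A) => _; apply. Qed.

Definition biginf A : L := bigsup (lbound A).

Lemma biginf_lb A x : A x -> biginf A <= x.
Proof. by move=> Ax; apply: bigsup_least => z; apply. Qed.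

Lemma biginf_greatest A z : (forall x, A x -> z <= x) -> z <= biginf A.
Proof. by move=> h; apply: bigsup_ub. Qed.

Definition himp a b : L := bigsup [set c | c `&` a <= b].

Lemma le_himp a b c : (c <= himp a b) = (c `&` a <= b).
Proof.
apply/idP/idP => [h|]; last exact: bigsup_ub.
apply: (@le_trans _ _ (himp a b `&` a)); first exact: leI2.
by rewrite meetC meet_bigsup; apply: bigsup_least => _ [z zab <-]; rewrite meetC.
Qed.

Definition rather_below a b : Prop :=
  exists c, a `&` c = \bot /\ b `|` c = \top.

(* A scale from a to b, indexed by the rationals of [0, 1]; f is irrelevant
   outside that interval. *)
Definition completely_below a b : Prop :=
  exists f : rat -> L, [/\ f 0%R = a, f 1%R = b
    & forall p q : rat, (0 <= p)%R -> (p < q)%R -> (q <= 1)%R ->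
        rather_below (f p) (f q)].

Definition max_elements : set L :=
  [set a | a <> \top /\ forall b, b <> \top -> a <= b -> b = a].

Definition successor a c : Prop := a < c /\ ~ exists b, a < b /\ b < c.

Definition is_subframe S : Prop :=
  [/\ S \top, (forall a b, S a -> S b -> S (a `&` b))
    & forall A, (A `<=` S)%classic -> S (bigsup A)].

Definition is_sublocale S : Prop :=
  (forall A, (A `<=` S)%classic -> S (biginf A)) /\
  (forall a s, S s -> S (himp a s)).

Definition pointless_part : set L := [set a | ~ exists c, successor a c].

Lemma pointless_part_sublocale : is_sublocale pointless_part.
Proof.
split=> [A Api|a s spi] [t [lt_t no_t]].
  have [u Au ntu] : exists2 u, A u & ~~ (t <= u).
    apply: contrapT => h; move/negbT/negP: (lt_geF lt_t); apply.
    apply: biginf_greatest => u Au; apply: contrapT => ntu.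
    by apply: h; exists u => //; apply/negP.
  have tu : t `&` u = biginf A.
    apply: contrapT => /eqP tu; apply: no_t; exists (t `&` u); split.
      by rewrite lt_neqAle eq_sym tu lexI (ltW lt_t) biginf_lb.
    by rewrite lt_neqAle leIl andbT; apply: contra ntu => /eqP <-; exact: leIr.
  apply: (Api u Au); exists (u `|` t); split.
    rewrite lt_neqAle leUl andbT; apply: contra ntu => /eqP ->; exact: leUr.
  move=> [b [ub but]]; apply: no_t; exists (b `&` t); split; last first.
    rewrite lt_neqAle leIr andbT; apply/negP => /eqP bt.
    move/negbT/negP: (lt_geF but); apply.
    by rewrite leUx (ltW ub) /= -bt leIl.
  rewrite lt_neqAle lexI (ltW lt_t) andbT.
  rewrite (le_trans (biginf_lb Au) (ltW ub)) andbT; apply/negP => /eqP bt.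
  have bE : b = b `&` (u `|` t) by apply/esym/meet_idPl; exact: ltW.
  move/negbT/negP: (lt_geF ub); apply.
  by rewrite bE meetUr -bt leUx leIr biginf_lb.
have nta : ~~ (t `&` a <= s) by rewrite -le_himp lt_geF.
apply: spi; exists (s `|` (t `&` a)); split.
  rewrite lt_neqAle leUl andbT; apply: contra nta => /eqP ->; exact: leUr.
move=> [b [sb bt]]; apply: no_t; exists (himp a s `|` (b `&` t)); split.
  rewrite lt_neqAle leUl andbT; apply/negP => /eqP e.
  have : b `&` t <= himp a s by rewrite e leUr.
  rewrite le_himp -meetA => bta.
  move/negbT/negP: (lt_geF sb); apply.
  have -> : b = b `&` (s `|` (t `&` a)) by apply/esym/meet_idPl; exact: ltW.
  by rewrite meetUr leUx leIr bta.
rewrite lt_neqAle leUx (ltW lt_t) leIr !andbT; apply/negP => /eqP e.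
move/negbT/negP: (lt_geF bt); apply; rewrite leUx (ltW sb) /= -e meetUl leUx.
rewrite (le_trans _ (ltW sb)) /=; last by rewrite -le_himp.
by rewrite (le_trans (leIl _ _)) // leIl.
Qed.

(* Filters are upward closed and contain \top, but may be improper. *)
Definition is_filter (x : set L) : Prop :=
  [/\ x \top, (forall a b, x a -> x b -> x (a `&` b))
    & forall a b, a <= b -> x a -> x b].

Definition round (x : set L) : Prop :=
  forall a, x a -> exists2 b, x b & completely_below b a.

Definition proper_round_filter (x : set L) : Prop :=
  [/\ is_filter x, ~ x \bot & round x].

Definition maximal_proper_round_filter (x : set L) : Prop :=
  proper_round_filter x /\
  forall y : set L, proper_round_filter y -> (x `<=` y)%classic -> y = x.

Definition independent (W : set (set L)) : Prop :=
  forall x y : set L, W x -> W y -> x <> y ->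
    exists a b, [/\ x a, y b & a `&` b = \bot].

Definition plenary (W : set (set L)) : Prop :=
  [/\ (W !=set0)%classic, independent W
    & forall a, \bot < a -> exists2 w : set L, W w & w a].

End FrameTheory.

Arguments max_elements {d} L.
Arguments pointless_part {d} L.
Arguments pointless_part_sublocale {d} L.

Definition completely_regular d (L : frameType d) : Prop :=
  forall a : L, a = bigsup [set b | completely_below b a].

(* In the terminology used here, a frame is nonempty when it is not the
   one-element frame. *)
Definition nonempty_frame d (L : frameType d) : Prop :=
  exists a b : L, a <> b.

Definition pointless d (L : frameType d) : Prop := max_elements L = set0.

(* A subframe or a sublocale, as a frame for the induced order. *)
Definition subframe_type d (L : frameType d) (S : set L)
  (_ : is_subframe S) : Type := set_type S.

Section SubframeType.
Context {d : Order.disp_t} {L : frameType d} {S : set L} (HS : is_subframe S).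
Local Notation T := (subframe_type HS).

HB.instance Definition _ := SubChoice.on T.
HB.instance Definition _ := [SubChoice_isSubPOrder of T by <: with d].

Let PS (x : T) : S (val x). Proof. exact: set_mem (valP x). Qed.

Let meet_in (x y : T) : val x `&` val y \in S.
Proof. by have [_ hm _] := HS; apply/mem_set/hm; exact: PS. Qed.

Let meet (x y : T) : T := exist _ (val x `&` val y) (meet_in x y).

Let lexI (x y z : T) : (x <= meet y z) = (x <= y) && (x <= z).
Proof. by rewrite !leEsub /= Order.MeetTheory.lexI. Qed.

HB.instance Definition _ := Order.POrder_isMeetSemilattice.Build d T lexI.

Let sup_in (A : set T) : bigsup [set val x | x in A]%classic \in S.
Proof. by have [_ _ hs] := HS; apply/mem_set/hs => _ [x _ <-]; exact: PS. Qed.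

Let sup (A : set T) : T :=
  exist _ (bigsup [set val x | x in A]%classic) (sup_in A).

Let supP (A : set T) : supremums A (sup A).
Proof.
split=> [x Ax|z Az]; rewrite leEsub /=; first by apply: bigsup_ub; exists x.
by apply: bigsup_least => _ [x Ax <-]; exact: (Az x Ax).
Qed.

Let meet_sup_le (x : T) (A : set T) :
  x `&` sup A <= sup [set (x `&` y)%O | y in A]%classic.
Proof.
rewrite leEsub /= meet_bigsup; apply: bigsup_least => _ [_ [y Ay <-] <-].
by apply: bigsup_ub; exists (x `&` y) => //; exists y.
Qed.

HB.instance Definition _ := MeetSemilattice_isFrame.Build d T supP meet_sup_le.

End SubframeType.

Definition subframe d (L : frameType d) (S : set L) (HS : is_subframe S) :
  frameType d := subframe_type HS.

Definition subframe_incl d (L : frameType d) (S : set L) (HS : is_subframe S)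
  (x : subframe HS) : L := val (x : subframe_type HS).

Definition sublocale_type d (L : frameType d) (S : set L)
  (_ : is_sublocale S) : Type := set_type S.

Section SublocaleType.
Context {d : Order.disp_t} {L : frameType d} {S : set L} (HS : is_sublocale S).
Local Notation T := (sublocale_type HS).

HB.instance Definition _ := SubChoice.on T.
HB.instance Definition _ := [SubChoice_isSubPOrder of T by <: with d].

Let PS (x : T) : S (val x). Proof. exact: set_mem (valP x). Qed.

Let meet_in (x y : T) : val x `&` val y \in S.
Proof.
have [hm _] := HS.
suff -> : val x `&` val y = biginf [set val x; val y]%classic.
  by apply/mem_set/hm => _ [->|->]; exact: PS.
apply/eqP; rewrite eq_le; apply/andP; split.
  by apply: biginf_greatest => _ [->|->]; rewrite ?leIl ?leIr.
by rewrite lexI; apply/andP; split; apply: biginf_lb; [left|right].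
Qed.

Let meet (x y : T) : T := exist _ (val x `&` val y) (meet_in x y).

Let lexI (x y z : T) : (x <= meet y z) = (x <= y) && (x <= z).
Proof. by rewrite !leEsub /= Order.MeetTheory.lexI. Qed.

HB.instance Definition _ := Order.POrder_isMeetSemilattice.Build d T lexI.

Fact quotient_map_in (b : L) : biginf [set a | S a /\ b <= a]%classic \in S.
Proof. by have [hm _] := HS; apply/mem_set/hm => a []. Qed.

(* Meets in a sublocale are those of the ambient frame. *)
Definition quotient_map (b : L) : T :=
  exist _ (biginf [set a | S a /\ b <= a]%classic) (quotient_map_in b).

Let quotient_map_le (b : L) (z : T) : (quotient_map b <= z) = (b <= val z).
Proof.
rewrite leEsub /=; apply/idP/idP => [|bz].
  by apply: le_trans; apply: biginf_greatest => a [].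
by apply: biginf_lb; split => //; exact: PS.
Qed.

Let sup (A : set T) : T := quotient_map (bigsup [set val x | x in A]%classic).

Let supP (A : set T) : supremums A (sup A).
Proof.
split=> [x Ax|z Az]; rewrite /sup; last first.
  rewrite quotient_map_le.
  by apply: bigsup_least => _ [x Ax <-]; exact: (Az x Ax).
rewrite leEsub /=; apply: biginf_greatest => a [_]; apply: le_trans.
by apply: bigsup_ub; exists x.
Qed.

Let meet_sup_le (x : T) (A : set T) :
  x `&` sup A <= sup [set (x `&` y)%O | y in A]%classic.
Proof.
set u := sup [set (x `&` y)%O | y in A]%classic.
have Su : himp (val x) (val u) \in S.
  by have [_ hi] := HS; apply/mem_set/hi; exact: PS.
pose v : T := exist _ (himp (val x) (val u)) Su.
suff : sup A <= v.
  by rewrite leEsub [X in _ <= X]/= le_himp meetC => h; rewrite leEsub.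
case: (supP A) => _; apply=> y Ay.
rewrite leEsub [X in _ <= X]/= le_himp meetC.
have : x `&` y <= u.
  by case: (supP [set (x `&` y)%O | y in A]%classic) => + _; apply; exists y.
by rewrite leEsub.
Qed.

HB.instance Definition _ := MeetSemilattice_isFrame.Build d T supP meet_sup_le.

End SublocaleType.

Definition sublocale d (L : frameType d) (S : set L) (HS : is_sublocale S) :
  frameType d := sublocale_type HS.

Definition sublocale_incl d (L : frameType d) (S : set L) (HS : is_sublocale S)
  (x : sublocale HS) : L := val (x : sublocale_type HS).

Definition sublocale_quotient d (L : frameType d) (S : set L)
  (HS : is_sublocale S) : L -> sublocale HS := quotient_map HS.

Definition pi_frame d (L : frameType d) : frameType d :=
  sublocale (pointless_part_sublocale L).

Definition pi_incl d (L : frameType d) : pi_frame L -> L :=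
  @sublocale_incl d L _ (pointless_part_sublocale L).

Definition pi_map d (L : frameType d) : L -> pi_frame L :=
  sublocale_quotient (pointless_part_sublocale L).

Section BoolFrame.

Let sup (A : set bool) : bool := `[< A true >].

Let supP (A : set bool) : supremums A (sup A).
Proof.
split=> [[] // Ax|z Az]; first by rewrite /sup asboolT.
by rewrite /sup; case: asboolP => // /Az.
Qed.

Let meet_sup (x : bool) (A : set bool) :
  x `&` sup A = sup [set (x `&` y)%O | y in A]%classic.
Proof.
rewrite /sup; case: x; rewrite ?meet1x ?meet0x.
  by congr asbool; apply/propext; split => [At|[[] At //]]; exists true.
by symmetry; apply/asboolP => -[].
Qed.

HB.instance Definition _ := TBDistrLattice_isFrame.Build _ bool supP meet_sup.

End BoolFrame.

Section FunFrame.
Context {I : Type} {d : Order.disp_t} {L : frameType d}.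
Local Notation T := (I -> L).

Let le0f (f : T) : ((fun=> \bot) : T) <= f. Proof. by apply/lefP => i; exact: le0x. Qed.
HB.instance Definition _ := @Order.hasBottom.Build _ T (fun=> \bot) le0f.

Let lef1 (f : T) : f <= ((fun=> \top) : T). Proof. by apply/lefP => i; exact: lex1. Qed.
HB.instance Definition _ := @Order.hasTop.Build _ T (fun=> \top) lef1.

Let meetUl : @left_distributive T T Order.meet Order.join.
Proof. by move=> f g h; apply/funext => i; rewrite !(meetfE, joinfE) meetUl. Qed.
HB.instance Definition _ := Order.Lattice_Meet_isDistrLattice.Build _ T meetUl.

Let sup (A : set T) : T := fun i => bigsup [set f i | f in A]%classic.

Let supP (A : set T) : supremums A (sup A).
Proof.
split=> [f Af|g Ag]; apply/lefP => i; first by apply: bigsup_ub; exists f.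
by apply: bigsup_least => _ [f Af <-]; move/lefP: (Ag _ Af).
Qed.

Let meet_sup (f : T) (A : set T) :
  f `&` sup A = sup [set (f `&` g)%O | g in A]%classic.
Proof.
apply/funext => i; rewrite meetfE /sup meet_bigsup; congr bigsup.
apply/predeqP => y; split => [[_ [g Ag <-] <-]|[_ [g Ag <-] <-]].
  by exists (f `&` g) => //; exists g.
by exists (g i) => //; exists g.
Qed.

HB.instance Definition _ := TBDistrLattice_isFrame.Build _ T supP meet_sup.

End FunFrame.

Section ProdFrame.
Context {d1 d2 d3 : Order.disp_t} {L1 : frameType d1} {L2 : frameType d2}.
Local Notation T := (L1 *prod[d3] L2).

Let sup (A : set T) : T :=
  (bigsup [set x.1 | x in A]%classic, bigsup [set x.2 | x in A]%classic).

Let supP (A : set T) : supremums A (sup A).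
Proof.
split=> [x Ax|z Az]; rewrite Order.ProdOrder.leEprod; apply/andP; split.
- by apply: bigsup_ub; exists x.
- by apply: bigsup_ub; exists x.
- apply: bigsup_least => _ [x Ax <-].
  by move: (Az _ Ax); rewrite Order.ProdOrder.leEprod => /andP[].
- apply: bigsup_least => _ [x Ax <-].
  by move: (Az _ Ax); rewrite Order.ProdOrder.leEprod => /andP[].
Qed.

Let meet_sup (x : T) (A : set T) :
  x `&` sup A = sup [set (x `&` y)%O | y in A]%classic.
Proof.
rewrite Order.ProdOrder.meetEprod /sup /= !meet_bigsup.
by congr (bigsup _, bigsup _); rewrite !image_comp.
Qed.

HB.instance Definition _ := TBDistrLattice_isFrame.Build _ T supP meet_sup.

End ProdFrame.

Section Construction.
Context {d : Order.disp_t} {E : frameType d} (W : set (set E)).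

(* The two-element frame is bool with false <= true, and its W-th power is
   W -> bool with the pointwise order, W being coerced to the type of its
   members. *)
Definition EW := E *p (W -> bool).

Definition chi (Z : set W) : W -> bool := fun w => w \in Z.

Definition Wset (a : E) : set W := [set w | val w a].

(* Lpp is L_W'' and Eprime is E'. *)
Definition Lpp : set EW :=
  [set x | exists (a : E) (Z : set W),
    [/\ x = (a, chi Z), (Z `<=` Wset a)%classic
      & finite_set (Wset a `\` Z)%classic]].

Definition Eprime : set EW := [set (a, chi (Wset a)) | a in setT]%classic.

(* All joins, including the empty and the infinite ones. *)
Definition Lstar : set EW :=
  [set bigsup A | A in [set A : set EW | A `<=` Lpp]]%classic.

Definition copoints : set EW :=
  [set (\top, chi (~` [set w])) | w in setT]%classic.

End Construction.

Arguments EW {d E} W.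
Arguments Lpp {d E} W.
Arguments Eprime {d E} W.
Arguments Lstar {d E} W.
Arguments copoints {d E} W.

(* Main.v *)
Require Import Defs.
From HB Require Import structures.
From mathcomp Require Import all_boot all_order all_algebra.
From mathcomp Require Import boolp classical_sets functions cardinality.
From mathcomp Require Import lra.
Set Implicit Arguments.
Unset Strict Implicit.
Unset Printing Implicit Defensive.
Import Order.TTheory.
Local Open Scope classical_set_scope.
Local Open Scope order_scope.

(** Write W_a for the set of members of W that contain a, and emb a for
    (a, chi W_a), so that E' is the image of emb.

    The one fact about filters that matters is a dichotomy: if b is completely
    below a, a maximal proper round filter contains a or the pseudocomplement
    b^* (maximal_round_filter_dichotomy); otherwise it could be enlarged by a
    and the other elements that b is completely below.  It has two consequences.

    - If b is completely below a, then emb (b^* ) is a witness in L* that emb b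
      is rather below emb a: the dichotomy says that W_a and W_(b^* ) cover W.
      So emb preserves the completely below relation, and as round filters
      make emb a the join of the emb b with b completely below a, every element
      of E' is a join of elements completely below it in L*.

    - For w in W, the join s of the a^* with a in w is \top, since the dichotomy
      shows that s would otherwise be maximal in the pointless frame E.  With
      independence of W this says that (\top, chi (W \ {w})) is the join of the
      emb (a^* ) with a in w (copoint_bigsup).

    Hence a subframe that contains E' contains the copoints, and then all of
    L_W'' and of L* (Lstar_least).  The elements of a frame that are joins of
    elements completely below them form a subframe; in L* it contains E', so it
    is everything and L* is completely regular.

    A maximal element (a, chi Z) of L* with Z <> W lies below a copoint, hence
    equals it; if Z = W, then a would be maximal in E.

    Every (b, chi Z) in L* satisfies Z <= W_b, so it lies below emb a exactly
    when b <= a: emb is right adjoint to the first projection L* -> E.  In a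
    completely regular frame a successor c of x makes the implication c -> x a
    maximal element (himp_successor_max).  If x = emb a had a successor c in
    L*, then c -> x would be a copoint, and comparing first coordinates in
    c /\ (c -> x) <= x would give c <= x.  So E' lies in the pointless part.
    Infima and implications with values in E' are computed in E through the
    adjunction, which also identifies the composite quotient map. *)

(** * Complete regularity and round filters in a frame *)

Section FrameLemmas.
Context {d : Order.disp_t} {L : frameType d}.
Implicit Types (a b c x y : L) (A : set L) (w : set L).

Definition pcompl a : L := himp a \bot.

Lemma le_pcompl a c : (c <= pcompl a) = (c `&` a == \bot).
Proof. by rewrite le_himp lex0. Qed.

Lemma meet_pcompl a : a `&` pcompl a = \bot.
Proof. by apply/eqP; rewrite meetC -le_pcompl. Qed.

Lemma bigsup_set0 : bigsup set0 = \bot :> L.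
Proof. by apply/eqP; rewrite -lex0; apply: bigsup_least. Qed.

Lemma rather_below_pcompl a b : rather_below a b -> b `|` pcompl a = \top.
Proof.
move=> [c [ac bc]]; apply/eqP; rewrite -le1x -bc leU2 // le_pcompl.
by rewrite meetC ac.
Qed.

Lemma rather_below_le a b : rather_below a b -> a <= b.
Proof.
move=> [c [ac bc]]; apply/meet_idPl.
by rewrite -[RHS]meetx1 -bc meetUr ac joinx0.
Qed.

Lemma rather_belowW a b b' : b <= b' -> rather_below a b -> rather_below a b'.
Proof.
move=> bb' [c [ac bc]]; exists c; split=> //.
by apply/eqP; rewrite -le1x -bc leU2.
Qed.

Lemma rather_belowI a a' b b' : rather_below a b -> rather_below a' b' ->
  rather_below (a `&` a') (b `&` b').
Proof.
move=> [c [ac bc]] [c' [ac' bc']]; exists (c `|` c'); split.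
  apply/eqP; rewrite -lex0 meetUr leUx -{1}ac -{1}ac'.
  by rewrite !leI2 ?leIl ?leIr.
apply/eqP; rewrite -le1x joinIl lexI -{1}bc -{1}bc'.
by rewrite !leU2 ?leUl ?leUr.
Qed.

Lemma completely_below_rather_below a b :
  completely_below a b -> rather_below a b.
Proof. by move=> [f [<- <- fP]]; apply: fP. Qed.

Lemma completely_below_le a b : completely_below a b -> a <= b.
Proof. by move/completely_below_rather_below/rather_below_le. Qed.

Lemma completely_belowW a b b' :
  b <= b' -> completely_below a b -> completely_below a b'.
Proof.
move=> bb' [f [f0 f1 fP]].
(* Only the last value of the scale is raised, from b to b'. *)
exists (fun p => if p == 1%R then b' else f p); split=> //.
move=> p q p0 pq q1; rewrite ifF; last first.
  by apply/negbTE; rewrite lt_eqF // (lt_le_trans pq).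
case: eqP => [q1'|_]; last exact: fP.
by apply: (rather_belowW bb'); rewrite -f1 -q1'; exact: fP.
Qed.

Lemma completely_belowI a a' b b' :
  completely_below a b -> completely_below a' b' ->
  completely_below (a `&` a') (b `&` b').
Proof.
move=> [f [<- <- fP]] [g [<- <- gP]]; exists (fun p => f p `&` g p); split=> //.
by move=> p q p0 pq q1; apply: rather_belowI; [exact: fP|exact: gP].
Qed.

Lemma completely_below_top : completely_below (\top : L) \top.
Proof.
exists (fun=> \top); split=> // _ _ _ _ _.
by exists \bot; rewrite meetx0 joinx0.
Qed.

(** An affine change of parameter turns the part of a scale between p and q into
    a scale on the whole of [0, 1]. *)
Lemma scale_completely_below (f : rat -> L) (p q : rat) :
    (forall s t : rat, (0 <= s)%R -> (s < t)%R -> (t <= 1)%R ->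
       rather_below (f s) (f t)) ->
    (0 <= p)%R -> (p < q)%R -> (q <= 1)%R ->
  completely_below (f p) (f q).
Proof.
move=> fP p0 pq q1; exists (fun t => f (p + t * (q - p))%R); split.
- by congr f; lra.
- by congr f; lra.
by move=> s t s0 st t1; apply: fP; nra.
Qed.

Lemma completely_below_interpolate a b : completely_below a b ->
  exists2 c, completely_below a c & completely_below c b.
Proof.
move=> [f [<- <- fP]]; exists (f (1 / 2)%R);
  by apply: scale_completely_below => //; lra.
Qed.

(** If b meets every member of w, then w together with all elements that b is
    completely below still generates a proper round filter, and a is in it.  If
    b is disjoint from a member of w, that member is below the pseudocomplement
    of b. *)
Lemma maximal_round_filter_dichotomy w a b :
    maximal_proper_round_filter w -> completely_below b a ->
  w a \/ w (pcompl b).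
Proof.
move=> [[[wT wI wle] w0 wround] wmax] ba.
pose G := [set y | exists x c, [/\ w x, completely_below b c & x `&` c <= y]].
have [[x [wx xb]]|nb] := pselect (exists x, w x /\ x `&` b = \bot).
  by right; apply: wle wx; rewrite le_pcompl xb.
left; suff <- : G = w by exists \top, a; rewrite leIr.
apply: wmax; last first.
  by move=> x wx; exists x, a; rewrite leIl.
split; first split.
- by exists \top, a; rewrite lex1.
- move=> y y' /= [x [c [wx bc xc]]] [x' [c' [wx' bc' xc']]].
  exists (x `&` x'), (c `&` c'); split; first exact: wI.
    by rewrite -[b]meetxx; exact: completely_belowI.
  by rewrite meetACA leI2.
- move=> y z yz [x [c [wx bc xc]]]; exists x, c; split=> //.
  exact: le_trans yz.
- move=> [x [c [wx bc xc]]]; apply: nb; exists x; split=> //.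
  apply/eqP; rewrite -lex0 (le_trans _ xc) // leI2 //.
  exact: completely_below_le.
move=> y [x [c [wx bc xc]]].
have [x' wx' x'x] := wround _ wx.
have [c' bc' c'c] := completely_below_interpolate bc.
exists (x' `&` c'); first by exists x', c'.
by apply: completely_belowW xc _; exact: completely_belowI.
Qed.

(** Without pointlessness, the join s of the pseudocomplements of the members of
    w is \top or maximal.  Indeed let b be completely below some t >= s with
    t <> \top.  If t were in w, some u in w would be completely below t, so t
    and the pseudocomplement of u, which is below s, would join to \top.
    Therefore w contains the pseudocomplement of b,
    whose own pseudocomplement is above b and below s. *)
Lemma bigsup_pcompl_filter w :
    completely_regular L -> pointless L -> maximal_proper_round_filter w ->
  bigsup [set pcompl y | y in w] = \top.
Proof.
move=> crL plL wmax; set s := bigsup _.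
apply: contrapT => sT; suff : max_elements L s by rewrite plL.
split=> // t tT st; apply/eqP; rewrite eq_le st andbT (crL t).
apply: bigsup_least => b bt.
have [wt|wb] := maximal_round_filter_dichotomy wmax bt; last first.
  apply: (@le_trans _ _ (pcompl (pcompl b))).
    by rewrite le_pcompl meet_pcompl.
  by apply: bigsup_ub; exists (pcompl b).
have [[_ _ wround] _] := wmax.
have [u wu ut] := wround _ wt; case: tT.
rewrite -(rather_below_pcompl (completely_below_rather_below ut)).
apply/esym/join_l; rewrite (le_trans _ st) //.
by apply: bigsup_ub; exists u.
Qed.

(** Reduces complete regularity of a frame to a set of generators. *)
Lemma completely_regular_part_subframe :
  is_subframe [set x : L | x = bigsup [set b | completely_below b x]].
Proof.
have intro x : x <= bigsup [set b | completely_below b x] ->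
    x = bigsup [set b | completely_below b x].
  move=> le_x; apply/eqP; rewrite eq_le le_x /=.
  by apply: bigsup_least => b; exact: completely_below_le.
split=> [|x y /= xE yE|A Acr]; apply: intro.
- by apply: bigsup_ub; exact: completely_below_top.
- rewrite -le_himp {1}xE; apply: bigsup_least => b bx.
  rewrite le_himp meetC -le_himp {1}yE; apply: bigsup_least => c cy.
  by rewrite le_himp meetC; apply: bigsup_ub; exact: completely_belowI.
apply: bigsup_least => x Ax; rewrite (Acr x Ax).
apply: bigsup_least => b bx; apply: bigsup_ub.
by apply: completely_belowW bx; exact: bigsup_ub.
Qed.

(** For t >= himp c a the element t `&` c lies between a and its successor c.  If
    it is a, then t <= himp c a.  If it is c, then t is above
    c `|` himp c a, which is \top: take x completely below c and not below a, so
    that a `|` x = c; then the pseudocomplement of x is below himp c a. *)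
Lemma himp_successor_max a c :
  completely_regular L -> successor a c -> max_elements L (himp c a).
Proof.
move=> crL [ac nac].
have ca : ~ c <= a by move=> ca; rewrite (le_gtF ca) in ac.
have between t : a <= t -> t <= c -> t = a \/ t = c.
  move=> at_ tc; have [->|ta] := eqVneq t a; first by left.
  have [->|tc'] := eqVneq t c; first by right.
  by case: nac; exists t; rewrite !lt_neqAle eq_sym ta at_ tc' tc.
have [x xc xa] : exists2 x, completely_below x c & ~ x <= a.
  apply: contrapT => h; apply: ca; rewrite (crL c); apply: bigsup_least => x xc.
  by apply: contrapT => xa; apply: h; exists x.
(* It suffices that himp c a is above the pseudocomplement of x. *)
have top_join : c `|` himp c a = \top.
  apply/eqP; rewrite -le1x.
  rewrite -(rather_below_pcompl (completely_below_rather_below xc)) leU2 //.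
  rewrite le_himp meetC.
  have [] := between (a `|` x); rewrite ?leUl //.
  - by rewrite leUx (ltW ac) completely_below_le.
  - by move=> e; case: xa; rewrite -e leUr.
  by move=> <-; rewrite meetUl meet_pcompl joinx0; exact: leIl.
split.
  by move=> e; apply: ca; rewrite -[c]meet1x -le_himp e.
move=> t tT st; apply/eqP; rewrite eq_le st andbT le_himp.
have [] := between (t `&` c); rewrite ?leIr //.
- by rewrite lexI (ltW ac) andbT (le_trans _ st) // le_himp leIl.
- by move=> ->.
move=> tc; case: tT; apply/eqP; rewrite -le1x -top_join leUx st andbT -tc.
exact: leIl.
Qed.

End FrameLemmas.

(** * Subframes and sublocales as frames *)
Section Subframes.
Context {d : Order.disp_t} {L : frameType d} {S : set L} (HS : is_subframe S).
Implicit Types (x y : subframe HS) (A : set (subframe HS)).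

Lemma subframe_inclP x : S (subframe_incl x).
Proof. exact: set_mem (valP (x : subframe_type HS)). Qed.

Lemma subframe_incl_inj : injective (@subframe_incl _ _ _ HS).
Proof. by move=> x y /val_inj. Qed.

Lemma subframe_inclE s : S s -> exists x, subframe_incl x = s.
Proof. by move=> Ss; exists (exist _ s (mem_set Ss)). Qed.

Lemma le_subframe_incl x y : (subframe_incl x <= subframe_incl y) = (x <= y).
Proof. by rewrite -leEsub. Qed.

Lemma subframe_inclI x y :
  subframe_incl (x `&` y) = subframe_incl x `&` subframe_incl y.
Proof. by []. Qed.

Lemma subframe_incl_bigsup A :
  subframe_incl (bigsup A) = bigsup [set subframe_incl x | x in A].
Proof. by []. Qed.

Lemma subframe_incl_top : subframe_incl (\top : subframe HS) = \top.
Proof.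
have [ST _ _] := HS; have [t tT] := subframe_inclE ST.
by apply/eqP; rewrite -le1x -tT le_subframe_incl lex1.
Qed.

Lemma subframe_incl_bot : subframe_incl (\bot : subframe HS) = \bot.
Proof. by rewrite -bigsup_set0 subframe_incl_bigsup image_set0 bigsup_set0. Qed.

Lemma subframe_inclU x y :
  subframe_incl (x `|` y) = subframe_incl x `|` subframe_incl y.
Proof.
have -> : x `|` y = bigsup [set x; y].
  apply/eqP; rewrite eq_le; apply/andP; split.
    by rewrite leUx; apply/andP; split; apply: bigsup_ub; [left|right].
  by apply: bigsup_least => _ [->|->]; rewrite ?leUl ?leUr.
rewrite subframe_incl_bigsup; apply/eqP; rewrite eq_le; apply/andP; split.
  by apply: bigsup_least => _ [_ [->|->] <-]; rewrite ?leUl ?leUr.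
rewrite leUx; apply/andP; split; apply: bigsup_ub.
  by exists x; [left|].
by exists y; [right|].
Qed.

(** Joins and meets of a subframe are those of the ambient frame, so the rather
    below relation of the subframe is the ambient one with the witness confined
    to the subframe. *)
Lemma subframe_rather_below x y c : S c ->
    subframe_incl x `&` c = \bot -> subframe_incl y `|` c = \top ->
  rather_below x y.
Proof.
move=> Sc; have [z <-] := subframe_inclE Sc => xz yz; exists z.
by split; apply: subframe_incl_inj;
  rewrite ?subframe_inclI ?subframe_inclU ?subframe_incl_bot ?subframe_incl_top.
Qed.

Lemma subframe_image (N : set (subframe HS)) :
  is_subframe N -> is_subframe [set subframe_incl x | x in N].
Proof.
move=> [NT NI Nsup]; split.
- by exists \top => //; exact: subframe_incl_top.
- move=> _ _ [x Nx <-] [y Ny <-]; exists (x `&` y) => //; exact: NI.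
move=> A AN; exists (bigsup [set x | N x /\ A (subframe_incl x)]).
  by apply: Nsup => x [].
rewrite subframe_incl_bigsup; congr bigsup; apply/seteqP; split.
  by move=> _ [x [_ Ax] <-].
by move=> s As; have [x Nx xs] := AN _ As; exists x => //; split; rewrite ?xs.
Qed.

End Subframes.

Section Sublocales.
Context {d : Order.disp_t} {L : frameType d} {S : set L} (HS : is_sublocale S).
Implicit Types (x y : sublocale HS).

Lemma sublocale_inclE s : S s -> exists x, sublocale_incl x = s.
Proof. by move=> Ss; exists (exist _ s (mem_set Ss)). Qed.

Lemma sublocale_inclP x : S (sublocale_incl x).
Proof. exact: set_mem (valP (x : sublocale_type HS)). Qed.

Lemma le_sublocale_incl x y :
  (sublocale_incl x <= sublocale_incl y) = (x <= y).
Proof. by rewrite -leEsub. Qed.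

(** The quotient map is left adjoint to the inclusion; everything about the two
    quotient maps of the theorem follows from this. *)
Lemma sublocale_quotient_le b x :
  (sublocale_quotient HS b <= x) = (b <= sublocale_incl x).
Proof.
rewrite -le_sublocale_incl; apply/idP/idP => [|bx].
  by apply: le_trans; apply: biginf_greatest => a [].
by apply: biginf_lb; split => //; exact: sublocale_inclP.
Qed.

End Sublocales.

(** * Coordinates in the product frame *)

Section Construction.
Context {d : Order.disp_t} {E : frameType d} (W : set (set E)).
Implicit Types (a b c : E) (w : W) (x y : EW W).

Definition emb a : EW W := (a, chi (Wset (W := W) a)).

Definition copoint w : EW W := (\top, chi (~` [set w])).

Lemma chiE (Z : set W) w : chi Z w = `[< Z w >].
Proof. by rewrite /chi /in_mem /=; apply/idP/asboolP => [/set_mem|/mem_set]. Qed.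

Lemma leEWP x y : (x <= y) <-> (x.1 <= y.1 /\ forall w, x.2 w -> y.2 w).
Proof.
rewrite Order.ProdOrder.leEprod.
have leb_imp (p q : bool) : (p <= q) = (p ==> q) by case: p q => [] [].
split=> [/andP[xy1 /lefP xy2]|[xy1 xy2]].
  by split=> // w; apply/implyP; rewrite -leb_imp.
by rewrite xy1; apply/lefP => w; rewrite leb_imp; apply/implyP; exact: xy2.
Qed.

Lemma bigsupEW1 (A : set (EW W)) : (bigsup A).1 = bigsup [set x.1 | x in A].
Proof. by []. Qed.

Lemma bigsupEW2 (A : set (EW W)) w :
  (bigsup A).2 w <-> exists2 x, A x & x.2 w.
Proof.
split=> [/asboolP [f [x Ax <-]] xw|[x Ax xw]]; first by exists x.
by apply/asboolP; exists x.2 => //; exists x.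
Qed.

Lemma meetEW x y : x `&` y = (x.1 `&` y.1, x.2 `&` y.2).
Proof. by []. Qed.

Lemma meetEW2 x y w : (x `&` y).2 w = x.2 w && y.2 w.
Proof. by rewrite meetEW /= meetfE. Qed.

Lemma joinEW2 x y w : (x `|` y).2 w = x.2 w || y.2 w.
Proof. by rewrite /= joinfE. Qed.

Lemma joinEW1 x y : (x `|` y).1 = x.1 `|` y.1.
Proof. by []. Qed.

Lemma Eprime_emb a : Eprime W (emb a).
Proof. by exists a. Qed.

End Construction.

(** * The family of joins and its generators *)

Section Lstar.
Context {d : Order.disp_t} {E : frameType d} (W : set (set E)).
Context (crE : completely_regular E) (plE : pointless E) (plenW : plenary W).
Context (maxW : forall w : set E, W w -> maximal_proper_round_filter w).
Implicit Types (a b c : E) (w u : W) (x y : EW W).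
Local Notation emb := (@emb d E W).

Lemma memberW w : W (val w).
Proof. exact: set_mem (valP w). Qed.

Lemma max_member w : maximal_proper_round_filter (val w).
Proof. exact/maxW/memberW. Qed.

Lemma member_top w : val w \top.
Proof. by have [[[]]] := max_member w. Qed.

Lemma member_le w a b : a <= b -> val w a -> val w b.
Proof. by have [[[_ _ wle] _ _] _] := max_member w; exact: wle. Qed.

Lemma memberI w a b : val w a -> val w b -> val w (a `&` b).
Proof. by have [[[_ wI _] _ _] _] := max_member w; exact: wI. Qed.

Lemma member_disjoint w a b : a `&` b = \bot -> val w a -> ~ val w b.
Proof.
move=> ab wa wb; have [[_ w0 _] _] := max_member w.
by apply: w0; rewrite -ab; exact: memberI.
Qed.

Lemma emb2 a w : (emb a).2 w <-> val w a.
Proof. by rewrite [_.2 _]chiE; split=> /asboolP. Qed.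

Lemma copoint2 w u : (copoint w).2 u <-> u <> w.
Proof. by rewrite [_.2 _]chiE; split=> /asboolP. Qed.

(** The condition Z `<=` Wset a for x = (a, chi Z); unlike finiteness of the
    difference, it survives arbitrary joins. *)
Definition subordinate x := forall w, x.2 w -> val w x.1.

Lemma subordinate_emb a : subordinate (emb a).
Proof. by move=> w /emb2. Qed.

(** The adjunction between the first projection and emb. *)
Lemma le_emb x a : subordinate x -> (x <= emb a) = (x.1 <= a).
Proof.
move=> xc; apply/idP/idP => [/leEWP[] //|xa]; apply/leEWP; split=> // w xw.
by apply/emb2; exact: member_le (xc w xw).
Qed.

Lemma emb_le a b : (emb a <= emb b) = (a <= b).
Proof. exact/le_emb/subordinate_emb. Qed.

Lemma embI a b : emb (a `&` b) = emb a `&` emb b.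
Proof.
apply/eqP; rewrite eq_le lexI !emb_le leIl leIr le_emb //= => w.
rewrite meetEW2 => /andP[/emb2 wa /emb2 wb]; exact: memberI.
Qed.

Lemma emb_top : emb \top = \top.
Proof.
apply/eqP; rewrite -le1x; apply/leEWP; split=> // w _; exact/emb2/member_top.
Qed.

Lemma Lpp_subordinate x : Lpp W x -> subordinate x.
Proof. by move=> [a [Z [-> Za _]]] w; rewrite /= chiE => /asboolP/Za. Qed.

Lemma Lstar_subordinate x : Lstar W x -> subordinate x.
Proof.
move=> [A AL <-] w /bigsupEW2 [y Ay yw].
apply: member_le (Lpp_subordinate (AL _ Ay) yw).
by rewrite bigsupEW1; apply: bigsup_ub; exists y.
Qed.

Lemma Lpp_Lstar : Lpp W `<=` Lstar W.
Proof.
move=> x xL; exists [set x]; first by move=> _ ->.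
by apply/eqP; rewrite eq_le bigsup_ub // andbT; apply: bigsup_least => _ ->.
Qed.

Lemma LppI x y : Lpp W x -> Lpp W y -> Lpp W (x `&` y).
Proof.
move=> [a [Y [-> Ya finY]]] [b [Z [-> Zb finZ]]].
exists (a `&` b), (Y `&` Z)%classic; split.
- rewrite meetEW /=; congr pair; apply/funext => w; rewrite meetfE !chiE.
  by rewrite /= asbool_and.
- by move=> w [/Ya wa /Zb wb]; exact: memberI.
have : finite_set ((Wset a `\` Y) `|` (Wset b `\` Z)) by rewrite finite_setU.
apply: sub_finite_set => w [wab nw].
have [Yw|nYw] := pselect (Y w); [right|left]; split=> //.
- by apply: member_le wab; exact: leIr.
- by move=> Zw; exact: nw.
- by apply: member_le wab; exact: leIl.
Qed.

Lemma Lpp_emb a : Lpp W (emb a).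
Proof. by exists a, (Wset a); split=> //; rewrite setDv; exact: finite_set0. Qed.

Lemma Lpp_copoint w : Lpp W (copoint w).
Proof.
exists \top, (~` [set w])%classic; split=> //.
  by move=> u _; exact: member_top.
apply: (@sub_finite_set _ _ [set w]%classic) => // u [_].
by rewrite /= notK.
Qed.

Lemma Lstar_subframe : is_subframe (Lstar W).
Proof.
split.
- by rewrite -emb_top; exact/Lpp_Lstar/Lpp_emb.
- move=> _ _ [A AL <-] [B BL <-].
  exists [set z | exists x y, [/\ A x, B y & z = x `&` y]].
    by move=> _ [x [y [/AL xL /BL yL ->]]]; exact: LppI.
  apply/eqP; rewrite eq_le; apply/andP; split.
    apply: bigsup_least => _ [x [y [Ax By ->]]].
    by apply: leI2; exact: bigsup_ub.
  rewrite -le_himp; apply: bigsup_least => x Ax.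
  rewrite le_himp meetC -le_himp; apply: bigsup_least => y By.
  by rewrite le_himp meetC; apply: bigsup_ub; exists x, y.
move=> A AL; exists [set z | Lpp W z /\ exists2 x, A x & z <= x].
  by move=> z [].
apply/eqP; rewrite eq_le; apply/andP; split.
  apply: bigsup_least => z [_ [x Ax zx]]; apply: le_trans zx _.
  exact: bigsup_ub.
apply: bigsup_least => x Ax; have [B BL Bx] := AL _ Ax.
rewrite -[x in x <= _]Bx; apply: bigsup_least => z Bz; apply: bigsup_ub.
by split; [exact: BL|exists x => //; rewrite -Bx; exact: bigsup_ub].
Qed.

(** The first coordinate is bigsup_pcompl_filter.  For the second, a member u of
    W contains the pseudocomplement of some element of w exactly when u and w
    have disjoint elements, which by independence means u <> w. *)
Lemma copoint_bigsup w :
  copoint w = bigsup [set emb (pcompl a) | a in val w].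
Proof.
apply/eqP; rewrite eq_le; apply/andP; split; last first.
  apply: bigsup_least => _ [a wa <-]; apply/leEWP; split; first exact: lex1.
  move=> u /emb2 ua; apply/copoint2 => uw; move: ua; rewrite uw.
  by apply: member_disjoint wa; exact: meet_pcompl.
apply/leEWP; split.
  rewrite /= -(bigsup_pcompl_filter crE plE (max_member w)).
  apply: bigsup_least => _ [a wa <-]; apply: bigsup_ub.
  by exists (emb (pcompl a)) => //; exists a.
move=> u /copoint2 uw; have [_ indW _] := plenW.
have [a [b [ua wb ab]]] : exists a b, [/\ val u a, val w b & a `&` b = \bot].
  apply: indW; [exact: memberW|exact: memberW|by move=> /val_inj].
apply/bigsupEW2; exists (emb (pcompl b)); first by exists b.
by apply/emb2; apply: member_le ua; rewrite le_pcompl ab.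
Qed.

(** Each (a, chi Z) in L_W'' is emb a cut down by the finitely many copoints that
    belong to members of Wset a outside Z, and the copoints are joins of
    elements of E'. *)
Lemma Lstar_least (M : set (EW W)) :
  is_subframe M -> Eprime W `<=` M -> Lstar W `<=` M.
Proof.
move=> [MT MI Msup] EM.
have copointM w : M (copoint w).
  rewrite copoint_bigsup; apply: Msup => _ [a _ <-]; apply: EM.
  exact: Eprime_emb.
suff LppM : Lpp W `<=` M.
  by move=> _ [A AL <-]; apply: Msup => x /AL/LppM.
move=> _ [a [Z [-> Za /finite_seqP [s sE]]]].
(* B s removes exactly the finitely many filters listed in s. *)
pose B (r : seq W) : EW W := \big[Order.meet / \top]_(w <- r) copoint w.
have B1 r : (B r).1 = \top.
  rewrite /B; elim/big_rec: _ => // w x _.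
  by rewrite meetEW /= => ->; rewrite meetxx.
have B2 r w : (B r).2 w = (w \notin r).
  rewrite /B; elim: r => [|v r IHr]; first by rewrite big_nil.
  rewrite big_cons meetEW2 IHr in_cons negb_or; congr andb.
  by apply/idP/idP => [/copoint2/eqP|/eqP/copoint2].
have -> : (a, chi Z) = B s `&` emb a :> EW W.
  rewrite meetEW; congr pair; first by rewrite B1 meet1x.
  apply/funext => w; rewrite meetfE B2.
  have sw : (w \in s) = `[< (Wset a `\` Z)%classic w >].
    by rewrite sE; apply/idP/asboolP.
  rewrite sw chiE [(emb a).2 w]chiE.
  apply/asboolP/andP => [Zw|[/asboolP nw /asboolP aw]].
    by split; apply/asboolP; [case|exact: Za].
  by apply: contrapT => nZw; apply: nw.
apply: (MI); last by apply: EM; exact: Eprime_emb.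
by rewrite /B; elim/big_rec: _ => // w x _ Mx; exact: MI.
Qed.

Lemma emb_bigsup a : emb a = bigsup [set emb b | b in [set b | completely_below b a]].
Proof.
apply/eqP; rewrite eq_le; apply/andP; split; last first.
  apply: bigsup_least => _ [b ba <-]; rewrite emb_le.
  exact: completely_below_le.
apply/leEWP; split.
  rewrite /= {1}(crE a); apply: bigsup_least => b ba; apply: bigsup_ub.
  by exists (emb b) => //; exists b.
move=> w /emb2 wa; have [[_ _ wround] _] := max_member w.
have [b wb ba] := wround _ wa.
by apply/bigsupEW2; exists (emb b); [exists b|exact/emb2].
Qed.

End Lstar.

(** * Regularity, maximal elements and pointless part *)

Section LstarFrame.
Context {d : Order.disp_t} {E : frameType d} (W : set (set E)).
Context (crE : completely_regular E) (plE : pointless E) (plenW : plenary W).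
Context (maxW : forall w : set E, W w -> maximal_proper_round_filter w).
Context (HL : is_subframe (Lstar W)).
Implicit Types (a b c : E) (w u : W) (x y : subframe HL).
Local Notation emb := (@emb d E W).

Lemma emb_subframe a : exists x, subframe_incl x = emb a.
Proof. exact/subframe_inclE/Lpp_Lstar/Lpp_emb. Qed.

Lemma subframe_subordinate x : subordinate (subframe_incl x).
Proof. exact/(Lstar_subordinate maxW)/subframe_inclP. Qed.

(** The join with the witness emb (pcompl a) is \top in the second coordinate
    because each filter of W contains b or pcompl a.  Being rather below in E is
    not enough for this. *)
Lemma emb_rather_below a b x y : completely_below a b ->
  subframe_incl x = emb a -> subframe_incl y = emb b -> rather_below x y.
Proof.
move=> ab xa yb; apply: (@subframe_rather_below _ _ _ HL _ _ (emb (pcompl a))).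
- exact/Lpp_Lstar/Lpp_emb.
- rewrite xa -embI // meet_pcompl; apply/eqP; rewrite -lex0; apply/leEWP.
  split=> // w /(subordinate_emb) w0.
  by have [[_ []]] := max_member maxW w.
rewrite yb; apply/eqP; rewrite -le1x; apply/leEWP; split.
  by rewrite joinEW1 (rather_below_pcompl (completely_below_rather_below ab)).
move=> w _; rewrite joinEW2; apply/orP.
by have [wb|wa] := maximal_round_filter_dichotomy (max_member maxW w) ab;
  [left|right]; apply/emb2.
Qed.

(** Any two terms of a scale are completely below one another, so the image
    of a scale under emb is again a scale. *)
Lemma emb_completely_below a b x y : completely_below a b ->
  subframe_incl x = emb a -> subframe_incl y = emb b -> completely_below x y.
Proof.
move=> [f [f0 f1 fP]] xa yb.
have [g gE] := choice emb_subframe.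
exists (g \o f); split=> /=.
- by apply: subframe_incl_inj; rewrite f0 gE xa.
- by apply: subframe_incl_inj; rewrite f1 gE yb.
move=> p q p0 pq q1; apply: (emb_rather_below _ (gE _) (gE _)).
exact: scale_completely_below.
Qed.

Lemma Lstar_completely_regular : completely_regular (subframe HL).
Proof.
have := subframe_image (completely_regular_part_subframe (L := subframe HL)).
move=> /(Lstar_least crE plE plenW maxW) LstarE x.
have [|y yE /subframe_incl_inj <-] // := LstarE _ _ (subframe_inclP x).
move=> _ [a _ <-]; have [y yE] := emb_subframe a; exists y; last exact: yE.
apply/eqP; rewrite eq_le; apply/andP; split; last first.
  by apply: bigsup_least => z; exact: completely_below_le.
rewrite -le_subframe_incl yE emb_bigsup //.
apply: bigsup_least => _ [b ba <-]; have [z zE] := emb_subframe b.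
rewrite -zE le_subframe_incl; apply: bigsup_ub.
exact: emb_completely_below ba zE yE.
Qed.

(** A maximal x whose second coordinate misses some w is below, hence equal to,
    the copoint of w.  If it misses nothing, enlarging the first coordinate of x
    keeps it in L*, so that coordinate would be maximal in the pointless E. *)
Lemma max_Lstar :
  @subframe_incl _ _ _ HL @` max_elements (subframe HL) = copoints W.
Proof.
have top_of x : subframe_incl x = \top -> x = \top.
  by move=> xT; apply: subframe_incl_inj; rewrite subframe_incl_top.
apply/seteqP; split; last first.
  move=> _ [w _ <-]; have [x xE] : exists x, subframe_incl x = copoint w.
    exact/subframe_inclE/Lpp_Lstar/Lpp_copoint.
  exists x => //; split.
    move=> xT; have : (copoint w).2 w by rewrite -xE xT subframe_incl_top.
    by move/copoint2.
  move=> y yT xy; apply/eqP; rewrite eq_le xy andbT -le_subframe_incl xE.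
  apply/leEWP; split=> [|u yu]; first exact: lex1.
  apply/copoint2 => uw; case: yT; apply: top_of; apply/eqP; rewrite -le1x.
  move: xy; rewrite -le_subframe_incl xE => /leEWP [xy1 xy2].
  apply/leEWP; split=> // v _; have [->|vw] := pselect (v = w).
    by rewrite -uw.
  by apply: xy2; apply/copoint2.
move=> _ [x [xT xmax] <-].
have [[w xw]|xall] := pselect (exists w, ~ (subframe_incl x).2 w).
  exists w => //; have [y yE] : exists y, subframe_incl y = copoint w.
    exact/subframe_inclE/Lpp_Lstar/Lpp_copoint.
  suff <- : y = x by rewrite yE.
  apply: xmax.
    move=> yT; have : (copoint w).2 w by rewrite -yE yT subframe_incl_top.
    by move/copoint2.
  rewrite -le_subframe_incl yE; apply/leEWP; split=> [|u xu]; first exact: lex1.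
  by apply/copoint2 => uw; apply: xw; rewrite -uw.
have {}xall w : (subframe_incl x).2 w.
  by apply: contrapT => xw; apply: xall; exists w.
suff : max_elements E (subframe_incl x).1 by rewrite plE.
split=> [x1T|b bT xb].
  by apply: xT; apply: top_of; apply/eqP; rewrite -le1x; apply/leEWP; rewrite x1T.
have [y yE] := emb_subframe b.
have yx : x `|` y = x.
  apply: xmax; last exact: leUl.
  move=> /(congr1 (@subframe_incl _ _ _ HL)).
  rewrite subframe_inclU yE subframe_incl_top => /(congr1 fst).
  by rewrite joinEW1 /= (join_idPr xb).
by apply/eqP; rewrite eq_le xb andbT -{1}yx subframe_inclU yE joinEW1 leUr.
Qed.

(** A successor y of x makes himp y x maximal, hence a copoint, with first
    coordinate \top.  So the first coordinate of y is that of y `&` himp y x <= x,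
    whence y <= x by the adjunction. *)
Lemma emb_pointless x a : subframe_incl x = emb a -> pointless_part _ x.
Proof.
move=> xE [y xy]; have := himp_successor_max Lstar_completely_regular xy.
have [xy' _] := xy.
set m := himp y x => mmax.
have : copoints W (subframe_incl m) by rewrite -max_Lstar; exists m.
move=> [w _ mE]; move: xy'; rewrite le_gtF //.
rewrite -le_subframe_incl xE le_emb //; last exact: subframe_subordinate.
have : y `&` m <= x by rewrite meetC -le_himp.
rewrite -le_subframe_incl subframe_inclI xE -mE => /leEWP [].
by rewrite meetEW /= meetx1.
Qed.

Local Notation P := (pi_frame (subframe HL)).
Local Notation incl := (fun p : P => subframe_incl (pi_incl p)).

Lemma emb_pi a : exists p : P, incl p = emb a.
Proof.
have [x xE] := emb_subframe a.
have [p pE] : exists p : P, pi_incl p = x.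
  exact/sublocale_inclE/emb_pointless/xE.
by exists p; rewrite pE.
Qed.

Lemma le_pi_emb (p q : P) a :
  incl q = emb a -> (p <= q) = ((incl p).1 <= a).
Proof.
move=> qE; rewrite -le_emb //; last exact: subframe_subordinate.
by rewrite -qE le_subframe_incl le_sublocale_incl.
Qed.

(** By the adjunction, order relations with an element of E' on the right are
    relations in E between first coordinates, so the infimum and the
    implication computed in E have the required universal properties. *)
Lemma Eprime_sublocale : is_sublocale [set p : P | Eprime W (incl p)].
Proof.
split=> [A AE|p q [a _ /esym qE]].
  pose B := [set a | exists2 p, A p & incl p = emb a].
  have [p pE] := emb_pi (biginf B).
  suff -> : biginf A = p by exists (biginf B).
  apply/eqP; rewrite eq_le; apply/andP; split.
    rewrite (le_pi_emb _ pE); apply: biginf_greatest => a [q Aq qE].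
    by rewrite -(le_pi_emb _ qE); exact: biginf_lb.
  apply: biginf_greatest => q Aq; have [a _ /esym qE] := AE _ Aq.
  by rewrite (le_pi_emb _ qE) pE; apply: biginf_lb; exists q.
have [r rE] := emb_pi (himp (incl p).1 a).
suff -> : himp p q = r by exists (himp (incl p).1 a).
have le_r s : (s <= himp p q) = (s <= r).
  by rewrite le_himp (le_pi_emb _ qE) (le_pi_emb _ rE) le_himp.
by apply/eqP; rewrite eq_le le_r lexx -le_r lexx.
Qed.

(** Two adjunctions say that the image of x is the least element of E' above x,
    and le_emb finds it. *)
Lemma quotient_pi (HE : is_sublocale [set p : P | Eprime W (incl p)]) x :
  incl (sublocale_incl (sublocale_quotient HE (pi_map x)))
  = emb (subframe_incl x).1.
Proof.
set q := sublocale_quotient HE _.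
have le_q (s : sublocale HE) b : incl (sublocale_incl s) = emb b ->
    (q <= s) = ((subframe_incl x).1 <= b).
  move=> sE; rewrite sublocale_quotient_le.
  rewrite [LHS]sublocale_quotient_le -le_subframe_incl.
  have -> : subframe_incl (sublocale_incl (sublocale_incl s)) = emb b by [].
  exact/le_emb/subframe_subordinate.
have [a _ /esym qE] := sublocale_inclP q.
have [p pE] := emb_pi (subframe_incl x).1.
have [s sE] : exists s : sublocale HE, sublocale_incl s = p.
  by apply: sublocale_inclE; exists (subframe_incl x).1.
rewrite [LHS]qE; congr emb; apply/eqP; rewrite eq_le -(le_q q a qE) lexx andbT.
have : q <= s by rewrite (le_q s (subframe_incl x).1) ?sE.
by rewrite -le_sublocale_incl sE (le_pi_emb _ pE) qE.
Qed.

End LstarFrame.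

Local Close Scope order_scope.

Theorem theorem8p1p4 (d : Order.disp_t) (E : frameType d) (W : set (set E))
  (crE : completely_regular E) (neE : nonempty_frame E) (plE : pointless E)
  (plenW : plenary W)
  (maxW : forall w : set E, W w -> maximal_proper_round_filter w) :
  exists HL : is_subframe (Lstar W),
    [/\ (* (1) *)
        completely_regular (subframe HL)
        /\ Eprime W `|` copoints W `<=` Lstar W
        /\ (forall M : set (EW W), is_subframe M ->
              Eprime W `|` copoints W `<=` M -> Lstar W `<=` M),
        (* (2) *)
        @subframe_incl _ _ _ HL @` max_elements (subframe HL) = copoints W
      & (* (3) *)
        Eprime W `<=` [set subframe_incl (pi_incl y) | y in
                         [set: pi_frame (subframe HL)]]
        /\ exists HE : is_sublocale [set y : pi_frame (subframe HL) |
                                      Eprime W (subframe_incl (pi_incl y))],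
             forall (x : subframe HL) (a : E) (Z : set W),
               subframe_incl x = (a, chi Z) ->
               subframe_incl (pi_incl (sublocale_incl
                 (sublocale_quotient HE (pi_map x)))) = (a, chi (Wset a))].
Proof.
exists (Lstar_subframe maxW); split.
- split; first exact: Lstar_completely_regular.
  split=> [x [[a _ <-]|[w _ <-]]|M Msub EM].
  + exact/Lpp_Lstar/Lpp_emb.
  + exact/Lpp_Lstar/Lpp_copoint.
  by apply: (Lstar_least crE plE plenW maxW) => // x Ex; apply: EM; left.
- exact: max_Lstar.
split=> [_ [a _ <-]|].
  by have [p pE] := emb_pi crE plE plenW maxW (Lstar_subframe maxW) a; exists p.
exists (Eprime_sublocale crE plE plenW maxW _) => x a Z xE.
by rewrite quotient_pi // xE.
Qed.
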